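(* If $m,n\geq 1$ are integers, then $\gamma_{2,2}(H_{m,n})\leq 2mn+m+n$.
   Context: The infinite truncated square tiling graph $H_{\infty,\infty}$ has vertex set $\{(a,(x,y)) : a\in\mathbb{Z}_4,\ (x,y)\in\mathbb{Z}^2\}$. Its edges are: $(a,(x,y))\sim(a+1,(x,y))$ with $a+1$ taken modulo 4 (so each $(x,y)$ carries a 4-cycle whose vertices $0,1,2,3$ are its top, right, bottom, left vertices); $(1,(x,y))\sim(3,(x+1,y))$; and $(0,(x,y))\sim(2,(x,y+1))$. For $(x,y)\in\mathbb{Z}^2$ the octagon $O_{x,y}$ is the 8-cycle through $(0,(x,y)),(1,(x,y)),(3,(x+1,y)),(0,(x+1,y)),(2,(x+1,y+1)),(3,(x+1,y+1)),(1,(x,y+1)),(2,(x,y+1))$, in this cyclic order. For positive integers $m,n$, $H_{m,n}$ is the finite subgraph consisting of $m$ rows of $n$ octagons each: the union of the octagons $O_{x,y}$ with $0\le x\le n-1$, $0\le y\le m-1$. For a graph $G$ and integers $1\le r\le t$, a set $T\subseteq V(G)$ is a $(t,r)$ broadcast (dominating set) of $G$ if every $u\in V(G)$ satisfies $\sum_{v\in T,\ d(u,v)<t}(t-d(u,v))\ge r$, where $d$ is the graph distance in $G$. For finite $G$, the $(t,r)$ broadcast domination number $\gamma_{t,r}(G)$ is the smallest cardinality of a $(t,r)$ broadcast of $G$. *)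

(* Defs.v *)
From HB Require Import structures.
From mathcomp Require Import all_boot all_order all_algebra.

Set Implicit Arguments.
Unset Strict Implicit.
Unset Printing Implicit Defensive.

Import GRing.Theory.

Record sgraph := SGraph {
  svertex :> finType;
  sedge : rel svertex;
  sedge_sym : symmetric sedge;
  sedge_irrefl : irreflexive sedge
}.

Section Broadcast.

Variable G : sgraph.
Implicit Types (u v : G) (T : {set G}).

Definition walk (k : nat) u v : bool :=
  [exists p : k.-tuple G, path (@sedge G) u p && (last u p == v)].

(* When u and v are connected, a shortest walk has length less than #|G|, so
   the search below finds it.  Otherwise the distance is infinite, which is
   encoded by None. *)
Definition gdist u v : option nat :=
  let k := find (fun k => walk k u v) (iota 0 #|G|) in
  if k < #|G| then Some k else None.

Definition signal (t : nat) u v : nat :=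
  if gdist u v is Some d then (if d < t then t - d else 0) else 0.

Definition broadcast (t r : nat) T : bool :=
  [forall u : G, r <= \sum_(v in T) signal t u v].

(* The default value [set: G] is itself a broadcast when r <= t, the only case
   in which this number is meaningful (see broadcast_numP). *)
Definition broadcast_num (t r : nat) : nat :=
  #|[arg min_(T < [set: G] | broadcast t r T) #|T|]|.

Lemma walk0 u : walk 0 u u.
Proof. by apply/existsP; exists [tuple]; rewrite /= eqxx. Qed.

Lemma gdistxx u : gdist u u = Some 0.
Proof.
rewrite /gdist; have : 0 < #|G| by apply/card_gt0P; exists u.
by case: #|G| => // n _ /=; rewrite walk0.
Qed.

Lemma gdistP u v d :
  gdist u v = Some d <-> walk d u v /\ (forall k, walk k u v -> d <= k).
Proof.
have shortw k : walk k u v -> exists2 j, j <= k & (j < #|G|) && walk j u v.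
  case/existsP => p /andP[pp /eqP pl].
  case/shortenP: pp pl => q pq uq /(_ _) sub ql.
  have sq : size q < #|G| by have := max_card (mem (u :: q)); rewrite (card_uniqP uq).
  exists (size q); last first.
    rewrite sq; apply/existsP; exists (in_tuple q).
    by rewrite pq ql eqxx.
  by have := uniq_leq_size (proj2 (andP uq)) sub; rewrite size_tuple.
rewrite /gdist; set k := find _ _; split.
  case: ifP => // kG [<-].
  have hk : has (fun k => walk k u v) (iota 0 #|G|).
    by rewrite has_find size_iota.
  split; first by have := nth_find 0 hk; rewrite nth_iota.
  move=> j /shortw[i ij /andP[iG wi]].
  rewrite leqNgt; apply/negP => jk.
  have ik : i < k by apply: leq_ltn_trans jk.
  by have := before_find 0 ik; rewrite nth_iota // wi.
case=> wd mind.
have [i id /andP[iG wi]] := shortw _ wd.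
have {}id : i = d by apply/eqP; rewrite eqn_leq id mind.
subst i.
have hk : has (fun k => walk k u v) (iota 0 #|G|).
  by apply/hasP; exists d => //; rewrite mem_iota.
have kG : k < #|G| by move: hk; rewrite has_find size_iota.
rewrite kG; congr Some; apply/eqP; rewrite eqn_leq; apply/andP; split.
  rewrite leqNgt; apply/negP => dk.
  by have := before_find 0 dk; rewrite nth_iota // wd.
by apply: mind; have := nth_find 0 hk; rewrite nth_iota.
Qed.

Lemma broadcast_setT t r : r <= t -> broadcast t r [set: G].
Proof.
move=> rt; apply/forallP => u; rewrite (bigD1 u) ?inE //= /signal gdistxx.
by case: t rt => [|t] rt; rewrite ?subn0 ?ltn0Sn (leq_trans rt) ?leq_addr.
Qed.

Lemma broadcast_numP t r : r <= t ->
  (exists2 T : {set G}, broadcast t r T & #|T| = broadcast_num t r) /\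
  (forall T : {set G}, broadcast t r T -> broadcast_num t r <= #|T|).
Proof.
move=> rt; rewrite /broadcast_num.
case: arg_minnP => [|T bT minT]; first exact: broadcast_setT.
by split=> //; exists T.
Qed.

End Broadcast.

Local Open Scope ring_scope.

(* In (a, (x, y)), the labels a = 0, 1, 2, 3 are the top, right, bottom and left
   vertices of the 4-cycle at (x, y). *)
Notation tile_vertex := ('Z_4 * (int * int))%type.

Definition Hinf_arc (u v : tile_vertex) : bool :=
  let: (a, (x, y)) := u in
  [|| v == (a + 1, (x, y)),
      (a == 1) && (v == (3, (x + 1, y)))
    | (a == 0) && (v == (2, (x, y + 1)))].

Definition Hinf_edge (u v : tile_vertex) : bool := Hinf_arc u v || Hinf_arc v u.

Definition octagon (x y : int) : seq tile_vertex :=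
  [:: (0, (x, y)); (1, (x, y));
      (3, (x + 1, y)); (0, (x + 1, y));
      (2, (x + 1, y + 1)); (3, (x + 1, y + 1));
      (1, (x, y + 1)); (2, (x, y + 1))].

Definition cycle_edge (c : seq tile_vertex) (u v : tile_vertex) : bool :=
  [&& u \in c, v \in c & (v == next c u) || (u == next c v)].

Definition H_vertices (m n : nat) : seq tile_vertex :=
  flatten [seq octagon x%:Z y%:Z | x <- iota 0 n, y <- iota 0 m].

(* Adjacency in the union of the octagons, each taken as an 8-cycle. *)
Definition H_edge (m n : nat) (u v : seq_sub (H_vertices m n)) : bool :=
  [exists x : 'I_n, exists y : 'I_m,
     cycle_edge (octagon x%:Z y%:Z) (val u) (val v)].

Lemma octagon_uniq x y : uniq (octagon x y).
Proof.
have x1 : (x + 1 == x) = false by apply/negbTE; rewrite -subr_eq0 addrC addKr.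
have y1 : (y + 1 == y) = false by apply/negbTE; rewrite -subr_eq0 addrC addKr.
by rewrite /= !inE !xpair_eqE !(eq_sym x) !(eq_sym y) !x1 !y1 !andbF.
Qed.

Lemma octagon_cycle x y : cycle Hinf_edge (octagon x y).
Proof.
by rewrite /= /Hinf_edge /Hinf_arc !xpair_eqE !eqxx.
Qed.

Lemma Hinf_edge_irrefl : irreflexive Hinf_edge.
Proof.
case=> a [x y]; rewrite /Hinf_edge orbb /Hinf_arc !xpair_eqE.
by case: a => [[|[|[|[|]]]] i].
Qed.

Lemma Hinf_edge_sym : symmetric Hinf_edge.
Proof. by move=> u v; rewrite /Hinf_edge orbC. Qed.

Lemma octagon_sub x y u v : cycle_edge (octagon x y) u v -> Hinf_edge u v.
Proof.
case/and3P => uc vc /orP[]/eqP->; first exact: next_cycle (octagon_cycle x y) uc.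
by rewrite Hinf_edge_sym; exact: next_cycle (octagon_cycle x y) vc.
Qed.

Lemma mem_H_vertices m n v :
  reflect (exists x y : nat,
             [/\ (x < n)%N, (y < m)%N & v \in octagon x%:Z y%:Z])
          (v \in H_vertices m n).
Proof.
apply: (iffP flattenP) => [[s /allpairsP[[x y] /= []]]|[x [y [xn ym vo]]]].
  by rewrite !mem_iota !add0n => xn ym -> vo; exists x, y.
exists (octagon x%:Z y%:Z) => //; apply/allpairsP; exists (x, y).
by rewrite !mem_iota.
Qed.

Lemma H_edge_sub m n (u v : seq_sub (H_vertices m n)) :
  H_edge u v -> Hinf_edge (val u) (val v).
Proof. by case/existsP => x /existsP[y] /octagon_sub. Qed.

Lemma H_edge_sym m n : symmetric (@H_edge m n).
Proof.
move=> u v; apply: eq_existsb => x; apply: eq_existsb => y.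
by rewrite /cycle_edge andbCA orbC.
Qed.

Lemma H_edge_irrefl m n : irreflexive (@H_edge m n).
Proof.
move=> u; case E: (H_edge u u) => //.
by have := H_edge_sub E; rewrite Hinf_edge_irrefl.
Qed.

Definition H (m n : nat) : sgraph :=
  SGraph (@H_edge_sym m n) (@H_edge_irrefl m n).

(* Main.v *)
Require Import Defs.
From mathcomp Require Import all_boot all_order all_algebra zify.
Import GRing.Theory.

(** A vertex outside T receives signal at least 2 as soon as it has two
neighbours in T, and a vertex of T sends 2 to itself.  Hence, in a bipartite
graph of minimum degree at least 2, each of the two colour classes is a (2,2)
broadcast.  The graph of octagons is such a graph: the parity of a + x + y
changes along every edge of the infinite tiling ([colour_edge]), and every
vertex lies on an octagon, where it has a successor and a predecessor that
differ ([next_neq_prev]).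

The bound is the size of a colour class.  The edges that join two different
4-cycles, namely n(m+1) horizontal and m(n+1) vertical ones, form a perfect
matching of the graph.  As each edge has exactly one end of each colour, a
colour class has n(m+1) + m(n+1) = 2mn + m + n elements; [link_ends] lists
them, link by link. *)

(** If the successor a of x were also its predecessor, x would be the
successor of a, and the cycle would close after two steps. *)
Lemma next_neq_prev (T : eqType) (c : seq T) (x : T) :
  uniq c -> 2 < size c -> x \in c -> next c x != prev c x.
Proof.
move=> uc sc xc; apply/eqP => nx_px.
have nnx : next c (next c x) = x by rewrite nx_px next_prev.
case/rot_to: xc => i p cE; move: nnx; rewrite -!(next_rot i uc).
move: uc sc; rewrite -(rot_uniq i) -(size_rot i) cE.
case: p {cE} => [|a [|b q]] //= /andP[xabq _] _ nnx.
move: xabq nnx; rewrite !inE !negb_or !eqxx => /and3P[xa xb _].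
by rewrite (eq_sym a) (negPf xa) => bx; rewrite bx eqxx in xb.
Qed.

Section Domination.
Variable G : sgraph.
Implicit Types (u v w : G) (T : {set G}).

Lemma gdist_edge {u v} : sedge u v -> gdist u v = Some 1.
Proof.
move=> uv; apply/gdistP; split=> [|[|//] /existsP[p]].
  by apply/existsP; exists [tuple v]; rewrite /= uv eqxx.
by rewrite tuple0 /= => /eqP uE; rewrite uE sedge_irrefl in uv.
Qed.

Lemma broadcast22 T :
    (forall u, u \notin T -> exists v w,
       [/\ v != w, v \in T, w \in T, sedge u v & sedge u w]) ->
  broadcast 2 2 T.
Proof.
move=> nbT; apply/forallP => u; have [uT|/nbT] := boolP (u \in T).
  by rewrite (bigD1 u) //= /signal gdistxx leq_addr.
case=> v [w [vw vT wT uv uw]].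
rewrite (bigD1 v) //= (bigD1 w) /=; last by rewrite wT eq_sym.
by rewrite /signal !gdist_edge //= addnA leq_addr.
Qed.

End Domination.

Section Tiling.

Local Open Scope ring_scope.

(** A parity on 'Z_4 is meaningful because 4 is even; this is why the closing
edge from a = 3 to a = 0 of each 4-cycle also changes the colour. *)
Definition colour (v : tile_vertex) : bool :=
  let: (a, (x, y)) := v in odd a (+) odd `|(x + y)%R|.

Lemma odd_absz_succ (z : int) : odd `|(z + 1)%R| = ~~ odd `|z|.
Proof. lia. Qed.

Lemma colour_arc u v : Hinf_arc u v -> colour v = ~~ colour u.
Proof.
case: u => a [x y]; case/or3P => [/eqP->|/andP[/eqP-> /eqP->]|/andP[/eqP-> /eqP->]].
- by rewrite /colour -addNb; congr (_ (+) _); case: a => [[|[|[|[|]]]] i].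
- by rewrite /colour addrAC odd_absz_succ addbN.
- by rewrite /colour addrA odd_absz_succ addbN.
Qed.

Lemma colour_edge u v : Hinf_edge u v -> colour v = ~~ colour u.
Proof. by case/orP => /colour_arc -> //; rewrite negbK. Qed.

(** The link between (1, (x, y)) and (3, (x + 1, y)), and the one between
(0, (x, y)) and (2, (x, y + 1)), are indexed by their left or lower tile; the
tests on x + y select the end at which [colour] is false. *)
Definition link_ends (m n : nat) : seq tile_vertex :=
  [seq if odd (x + y) then (1, (x%:Z, y%:Z)) else (3, (x%:Z + 1, y%:Z))
     | x <- iota 0 n, y <- iota 0 m.+1] ++
  [seq if odd (x + y) then (2, (x%:Z, y%:Z + 1)) else (0, (x%:Z, y%:Z))
     | x <- iota 0 n.+1, y <- iota 0 m].

Lemma size_link_ends m n : size (link_ends m n) = (2 * m * n + m + n)%N.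
Proof. by rewrite size_cat !size_allpairs !size_iota; lia. Qed.

Lemma mem_horizontal_link m n x y : (x < n)%N -> (y <= m)%N ->
  (if odd (x + y) then (1, (x%:Z, y%:Z)) else (3, (x%:Z + 1, y%:Z)))
    \in link_ends m n.
Proof.
move=> xn ym; rewrite mem_cat; apply/orP; left; apply/allpairsP.
by exists (x, y); rewrite !mem_iota.
Qed.

Lemma mem_vertical_link m n x y : (x <= n)%N -> (y < m)%N ->
  (if odd (x + y) then (2, (x%:Z, y%:Z + 1)) else (0, (x%:Z, y%:Z)))
    \in link_ends m n.
Proof.
move=> xn ym; rewrite mem_cat; apply/orP; right; apply/allpairsP.
by exists (x, y); rewrite !mem_iota.
Qed.

(** The four links of an octagon, every other one of its edges, cover its eight
vertices. *)
Lemma mem_link_ends m n v :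
  v \in H_vertices m n -> ~~ colour v -> v \in link_ends m n.
Proof.
case/mem_H_vertices => x [y [xn ym]].
have := mem_horizontal_link m n x y xn (ltnW ym).
have := mem_horizontal_link m n x y.+1 xn ym.
have := mem_vertical_link m n x y (ltnW xn) ym.
have := mem_vertical_link m n x.+1 y xn ym.
rewrite !(addSn, addnS) /= !(intS x) !(intS y) !(addrC 1).
move=> vr vl ht hb.
have xy_parity : odd `|(x%:Z + y%:Z)%R| = odd (x + y) by [].
rewrite !inE; do !case/orP; move/eqP=> ->;
  rewrite /colour ?addrA ?(addrAC _ 1) ?odd_absz_succ xy_parity;
  by case: (odd (x + y)) vr vl ht hb.
Qed.

(** Minimum degree 2, boundary included: the graph is a union of cycles, so a
vertex has the two neighbours that precede and follow it on an octagon. *)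
Lemma H_edge_next_prev m n (u : H m n) :
  exists v w : H m n, [/\ v != w, sedge u v & sedge u w].
Proof.
have [x [y [xn ym uO]]] := mem_H_vertices _ _ _ (valP u).
have inH z : z \in octagon x y -> z \in H_vertices m n.
  by move=> zO; apply/mem_H_vertices; exists x, y.
have nO : next (octagon x y) (val u) \in octagon x y by rewrite mem_next.
have pO : prev (octagon x y) (val u) \in octagon x y by rewrite mem_prev.
exists (SeqSub (inH _ nO)), (SeqSub (inH _ pO)); split.
- by rewrite -val_eqE; apply: next_neq_prev; rewrite ?octagon_uniq.
- apply/existsP; exists (Ordinal xn); apply/existsP; exists (Ordinal ym).
  by rewrite /cycle_edge uO nO eqxx.
- apply/existsP; exists (Ordinal xn); apply/existsP; exists (Ordinal ym).
  by rewrite /cycle_edge uO pO next_prev ?octagon_uniq // eqxx orbT.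
Qed.

Definition even_class m n : {set H m n} := [set u | ~~ colour (val u)].

Lemma broadcast_even_class m n : broadcast 2 2 (even_class m n).
Proof.
apply: broadcast22 => u; rewrite inE negbK => u_odd.
have [v [w [vw uv uw]]] := H_edge_next_prev m n u.
exists v, w; rewrite !inE.
by rewrite !(colour_edge _ _ (H_edge_sub uv), colour_edge _ _ (H_edge_sub uw)) u_odd.
Qed.

Lemma card_even_class m n : (#|even_class m n| <= 2 * m * n + m + n)%N.
Proof.
rewrite -size_link_ends cardE -(size_map val).
apply: uniq_leq_size => [|z /mapP[u]].
  by rewrite map_inj_uniq ?enum_uniq //; exact: val_inj.
rewrite mem_enum inE => u_even ->.
exact: mem_link_ends (valP u) u_even.
Qed.

End Tiling.

Theorem corollary5p1 (m n : nat) (hm : 1 <= m) (hn : 1 <= n) :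
  broadcast_num (H m n) 2 2 <= 2 * m * n + m + n.
Proof.
have [_ minT] := broadcast_numP (H m n) (leqnn 2).
exact: leq_trans (minT _ (broadcast_even_class m n)) (card_even_class m n).
Qed.
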